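(* Let $\Gamma$ be a finite group, $(G,\phi)$ a $\Gamma$-symmetric looped simple graph, $\tau:\Gamma\to O(\mathbb{R}^2)$ a homomorphism with $\tau(\Gamma)$ one of the groups $C_s$, $C_n$ or $C_{nv}$, and let $(G,p,q)$ be a linearly constrained framework in $\mathbb{R}^2$ that is $\Gamma$-symmetric with respect to $\phi$ and $\tau$ and is isostatic. Then $G$ is $\tau(\Gamma)$-tight.
   Context: A looped simple graph $G=(V,E,L)$: finite vertex set, edges unordered pairs of distinct vertices (no multiple edges), loops each incident to one vertex (possibly several per vertex). $G$ is sparse if $|E'|+|L'|\le 2|V'|$ for every subgraph $(V',E',L')$ and $|E'|\le 2|V'|-3$ for every loopless subgraph with $E'\neq\emptyset$; tight if sparse and $|E|+|L|=2|V|$. $(G,\phi)$ is $\Gamma$-symmetric if $\phi:\Gamma\to\mathrm{Aut}(G)$ is a homomorphism (automorphisms = permutations of $V$ and $L$ preserving adjacency and incidence). $\gamma$ fixes vertex $v$ if $\gamma v=v$, edge $uw$ if ($\gamma u=u,\gamma w=w$) or ($\gamma u=w,\gamma w=u$), loop $l$ if $\gamma l=l$; loops can only be fixed by elements of order $\le2$. Framework $(G,p,q)$: injective $p:V\to\mathbb{R}^2$, $q:L\to\mathbb{R}^2$; infinitesimal motions $\dot p$: $(p(u)-p(w))\cdot(\dot p(u)-\dot p(w))=0$ for $uw\in E$, $q(l)\cdot\dot p(v)=0$ for loops $l$ at $v$; isostatic means the $(|E|+|L|)\times2|V|$ coefficient matrix has rank $2|V|$ with independent rows. $\Gamma$-symmetric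 w.r.t. $\phi,\tau$: $\tau(\gamma)p(v)=p(\gamma v)$; $\tau(\gamma)q(l)=q(\gamma l)$ for $\gamma$ of order not $2$; $\tau(\gamma)q(l)=-q(l)$ if $\tau(\gamma)$ is the half-turn and $\gamma$ fixes $l$; $\tau(\gamma)q(l)=\pm q(l)$ if $\tau(\gamma)$ is a reflection and $\gamma$ fixes $l$. $c_n$ = rotation by $2\pi/n$ about the origin; $C_s$ = group generated by a reflection $\sigma$; $C_n$ = group generated by $c_n$; $C_{nv}$ = group generated by $c_n$ ($n\ge2$) and a reflection. For $\gamma$ with $\tau(\gamma)=c_n$, $v_n,e_n,l_n$ = numbers of vertices, edges, loops fixed by $\gamma$. For a reflection $\sigma=\tau(\gamma)$: $e_\sigma$ = number of edges fixed by $\gamma$; $l_{\sigma,+}$ (resp. $l_{\sigma,-}$) = number of loops $l$ fixed by $\gamma$ with $\tau(\gamma)q(l)=q(l)$ (resp. $=-q(l)$). $(G,\phi)$ is $\tau(\Gamma)$-tight if $G$ is tight, $\Gamma$-symmetric, and: for $C_s$: $e_\sigma+l_{\sigma,+}=l_{\sigma,-}$; for $C_n$, $n\ne 2,4$: $v_n=e_n=l_n=0$; for $C_2$: $v_2=e_2=l_2=0$ or ($v_2=1,e_2=0,l_2=2$); for $C_4$: $v_2=v_4=e_2=e_4=l_2=l_4=0$ or ($v_2=v_4=1$, $e_2=e_4=0$, $l_2=2$, $l_4=0$); for $C_{2v}$: $e_\sigma+l_{\sigma,+}=l_{\sigma,-}$ (for each reflection) and the $C_2$ condition; for $C_{4v}$: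 $e_\sigma+l_{\sigma,+}=l_{\sigma,-}$ and the $C_4$ condition; for $C_{nv}$, $n\ne2,4$: $e_\sigma+l_{\sigma,+}=l_{\sigma,-}$ and $v_n=e_n=l_n=0$.
   Formalization: The formal statement also assumes τ(γ)q(l) = ±q(γl) when γ has order 2 and does not fix l; without this the claim fails (e.g. for C_s on four vertices with one loop each). C_n is taken with n ≥ 2. *)

(* Defs.v *)
From HB Require Import structures.
From mathcomp Require Import all_boot all_order all_fingroup all_algebra all_character.
From mathcomp Require Import all_classical all_reals all_analysis.

Set Implicit Arguments.
Unset Strict Implicit.
Unset Printing Implicit Defensive.

Import Order.TTheory GRing.Theory Num.Theory.
Local Open Scope classical_set_scope.
Local Open Scope ring_scope.

(* Several loops may share a base vertex, hence a separate type of loops. *)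
Record looped_graph := LoopedGraph {
  vert : finType;
  loop : finType;
  edges : {set {set vert}};
  base : loop -> vert;
  edges_card2 : forall e, e \in edges -> #|e| = 2%N
}.

Definition is_subgraph (G : looped_graph) (V' : {set vert G})
    (E' : {set {set vert G}}) (L' : {set loop G}) : Prop :=
  [/\ E' \subset edges G,
      forall e, e \in E' -> e \subset V'
    & forall l, l \in L' -> base l \in V'].

(* [#|E'| <= 2 #|V'| - 3] is written without truncated subtraction. *)
Definition sparse (G : looped_graph) : Prop :=
  (forall V' E' L', @is_subgraph G V' E' L' -> (#|E'| + #|L'| <= 2 * #|V'|)%N)
  /\ (forall V' E', @is_subgraph G V' E' finset.set0 -> E' != finset.set0 ->
        (#|E'| + 3 <= 2 * #|V'|)%N).

Definition tight (G : looped_graph) : Prop :=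
  sparse G /\ (#|edges G| + #|loop G| = 2 * #|vert G|)%N.

Definition is_automorphism (G : looped_graph)
    (s : {perm vert G}) (t : {perm loop G}) : Prop :=
  (forall u w, ([set s u; s w]%SET \in edges G) = ([set u; w]%SET \in edges G))
  /\ (forall l, base (t l) = s (base l)).

(* The homomorphism phi : Gamma -> Aut(G) is given by its components on        *)
(* vertices and loops. It is a homomorphism for composition of functions (a    *)
(* left action), which is the opposite of the product of {perm _}.             *)
Definition symmetric_graph (gT : finGroupType) (G : looped_graph)
    (phiV : gT -> {perm vert G}) (phiL : gT -> {perm loop G}) : Prop :=
  [/\ forall g, is_automorphism (phiV g) (phiL g),
      forall g h v, phiV (g * h)%g v = phiV g (phiV h v)
    & forall g h l, phiL (g * h)%g l = phiL g (phiL h l)].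

Section FixedElements.
Variables (gT : finGroupType) (G : looped_graph).
Variables (phiV : gT -> {perm vert G}) (phiL : gT -> {perm loop G}) (g : gT).

Definition fixed_vertices : {set vert G} := [set v | phiV g v == v]%SET.

Definition fixes_pair (u w : vert G) : bool :=
  ((phiV g u == u) && (phiV g w == w)) || ((phiV g u == w) && (phiV g w == u)).

Definition fixed_edges : {set {set vert G}} :=
  [set e in edges G |
    [exists u, [exists w, (e == [set u; w]%SET) && fixes_pair u w]]]%SET.

Definition fixed_loops : {set loop G} := [set l | phiL g l == l]%SET.

End FixedElements.

Section PlaneGroups.
Variable R : realType.

Definition rotation_mx (n : nat) : 'M[R]_2 :=
  let t := 2 * pi / n%:R in
  \matrix_(i, j) if i == j then cos t else if i == 0 then - sin t else sin t.

(* reflection in the line spanned by the unit vector u: x |-> 2 (u . x) u - x *)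
Definition is_reflection (s : 'M[R]_2) : Prop :=
  exists u : 'cV[R]_2, u^T *m u = 1%:M /\ s = 2 *: (u *m u^T) - 1%:M.

Definition mx_subgroup (H : set 'M[R]_2) : Prop :=
  [/\ H 1%:M,
      forall A B, H A -> H B -> H (A *m B)
    & forall A, H A -> H (invmx A)].

Definition generated (S : set 'M[R]_2) : set 'M[R]_2 := smallest mx_subgroup S.

Definition is_Cs (T : set 'M[R]_2) : Prop :=
  exists2 s, is_reflection s & T = generated [set s].

Definition is_Cn (n : nat) (T : set 'M[R]_2) : Prop :=
  T = generated [set rotation_mx n].

Definition is_Cnv (n : nat) (T : set 'M[R]_2) : Prop :=
  exists2 s, is_reflection s & T = generated [set rotation_mx n; s].

(* n = 1 is excluded: C_1 is trivial and C_1v is C_s *)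
Definition is_Cs_Cn_or_Cnv (T : set 'M[R]_2) : Prop :=
  [\/ is_Cs T,
      exists2 n, (2 <= n)%N & is_Cn n T
    | exists2 n, (2 <= n)%N & is_Cnv n T].

Definition orthogonal_repr (gT : finGroupType) (tau : gT -> 'M[R]_2) : Prop :=
  mx_repr [set: gT]%SET tau /\ forall g, (tau g)^T *m tau g = 1%:M.

End PlaneGroups.

Section Frameworks.
Variables (R : realType) (G : looped_graph).
Variables (p : vert G -> 'cV[R]_2) (q : loop G -> 'cV[R]_2).

Definition dot (x y : 'cV[R]_2) : R := (x^T *m y) 0 0.

Definition infinitesimal_motion (m : vert G -> 'cV[R]_2) : Prop :=
  (forall u w, [set u; w]%SET \in edges G -> dot (p u - p w) (m u - m w) = 0)
  /\ (forall l, dot (q l) (m (base l)) = 0).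

(* For e = {u, w} the sum is p u - p w at v = u and p w - p u at v = w. *)
Definition edge_coef (e : {set vert G}) (v : vert G) : 'cV[R]_2 :=
  if v \in e then \sum_(w in e) (p v - p w) else 0.

Definition loop_coef (l : loop G) (v : vert G) : 'cV[R]_2 :=
  if v == base l then q l else 0.

Definition flat_row (m : vert G -> 'cV[R]_2) : 'rV[R]_(#|vert G| * 2) :=
  mxvec (\matrix_(i, k) m (enum_val i) k 0).

Definition rigidity_mx : 'M[R]_(#|edges G| + #|loop G|, #|vert G| * 2) :=
  col_mx (\matrix_(i < #|edges G|) flat_row (edge_coef (enum_val i)))
         (\matrix_(i < #|loop G|) flat_row (loop_coef (enum_val i))).

Definition isostatic : Prop :=
  \rank rigidity_mx = (2 * #|vert G|)%N /\ row_free rigidity_mx.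

Lemma dotE x y : dot x y = \sum_k x k 0 * y k 0.
Proof. by rewrite /dot mxE; apply: eq_bigr => k _; rewrite mxE. Qed.

Lemma flat_row_dot (a m : vert G -> 'cV[R]_2) :
  (flat_row a *m (flat_row m)^T) 0 0 = \sum_v dot (a v) (m v).
Proof.
rewrite [RHS](reindex _ (onW_bij _ (enum_val_bij _))) /=.
under [RHS]eq_bigr => i _ do rewrite dotE.
rewrite pair_bigA /= mxE (reindex _ (curry_mxvec_bij _ _)) /=.
by apply: eq_bigr => -[i k] _; rewrite [X in _ * X]mxE /flat_row !mxvecE !mxE.
Qed.

Lemma edge_coef_dot u w (m : vert G -> 'cV[R]_2) : u != w ->
  \sum_v dot (edge_coef [set u; w]%SET v) (m v) = dot (p u - p w) (m u - m w).
Proof.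
move=> uw.
rewrite (bigD1 u) //= (bigD1 w) /=; last by rewrite eq_sym.
rewrite big1 ?addr0; last first.
  move=> v /andP[vu vw]; rewrite /edge_coef !inE (negbTE vu) (negbTE vw) /=.
  by rewrite /dot trmx0 mul0mx mxE.
rewrite /edge_coef !inE !eqxx orbT /= !big_setU1 ?inE //= !big_set1.
rewrite !subrr addr0 add0r !dotE -big_split /=.
by apply: eq_bigr => k _; rewrite !mxE mulrBr -[p w k 0 - _]opprB mulNr.
Qed.

Lemma rigidity_mxP (m : vert G -> 'cV[R]_2) :
  rigidity_mx *m (flat_row m)^T = 0 <-> infinitesimal_motion m.
Proof.
rewrite /rigidity_mx mul_col_mx.
have rowE k (F : 'I_k -> vert G -> 'cV[R]_2) i :
    ((\matrix_j flat_row (F j)) *m (flat_row m)^T) i 0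
      = \sum_v dot (F i v) (m v).
  by rewrite -flat_row_dot !mxE; apply: eq_bigr => j _; rewrite !mxE.
have loopE l : \sum_v dot (loop_coef l v) (m v) = dot (q l) (m (base l)).
  rewrite (bigD1 (base l)) //= big1 ?addr0 /loop_coef ?eqxx //.
  by move=> v /negbTE ->; rewrite /dot trmx0 mul0mx mxE.
split=> [|[mE mL]].
  rewrite -[X in _ = X](@col_mx0 _ _ _ 1) => /eq_col_mx[mE mL]; split=> [u w uwE|l].
    have uw : u != w.
      by apply/eqP => uw; have := edges_card2 uwE; rewrite uw finset.setUid cards1.
    rewrite -edge_coef_dot //.
    have /matrixP/(_ (enum_rank_in uwE [set u; w]%SET) 0) := mE.
    by rewrite rowE enum_rankK_in // => ->; rewrite mxE.
  rewrite -loopE; have /matrixP/(_ (enum_rank l) 0) := mL.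
  by rewrite rowE enum_rankK => ->; rewrite mxE.
rewrite -[RHS](@col_mx0 _ _ _ 1); congr col_mx; apply/matrixP => i j; rewrite ord1 rowE mxE.
  have eE := enum_valP i; move/eqP: (edges_card2 eE).
  case/cards2P=> u [w [uw e_uw]].
  by rewrite e_uw edge_coef_dot // mE // -e_uw.
by rewrite loopE.
Qed.

End Frameworks.

Section SymmetricFrameworks.
Variables (R : realType) (gT : finGroupType) (G : looped_graph).
Variables (phiV : gT -> {perm vert G}) (phiL : gT -> {perm loop G}).
Variable tau : gT -> 'M[R]_2.

(* The last clause concerns involutions that move l. Only the line spanned by  *)
(* q l matters; requiring equality there would exclude loops with              *)
(* tau g *m q l = - q l, e.g. off the origin for C_2v.                         *)
Definition symmetric_framework
    (p : vert G -> 'cV[R]_2) (q : loop G -> 'cV[R]_2) : Prop :=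
  [/\ forall g v, tau g *m p v = p (phiV g v),
      forall g l, #[g]%g <> 2%N -> tau g *m q l = q (phiL g l),
      forall g l, tau g = rotation_mx R 2 -> phiL g l = l ->
        tau g *m q l = - q l,
      forall g l, is_reflection (tau g) -> phiL g l = l ->
        tau g *m q l = q l \/ tau g *m q l = - q l
    & forall g l, #[g]%g = 2%N -> phiL g l <> l ->
        tau g *m q l = q (phiL g l) \/ tau g *m q l = - q (phiL g l)].

Variable q : loop G -> 'cV[R]_2.

Let v_ g := #|fixed_vertices phiV g|.
Let e_ g := #|fixed_edges phiV g|.
Let l_ g := #|fixed_loops phiL g|.

Definition loops_plus (g : gT) : {set loop G} :=
  [set l in fixed_loops phiL g | tau g *m q l == q l]%SET.

Definition loops_minus (g : gT) : {set loop G} :=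
  [set l in fixed_loops phiL g | tau g *m q l == - q l]%SET.

Definition reflection_count : Prop := forall g, is_reflection (tau g) ->
  (e_ g + #|loops_plus g| = #|loops_minus g|)%N.

Definition rotation_count (n : nat) : Prop :=
  forall g, tau g = rotation_mx R n -> [/\ v_ g = 0, e_ g = 0 & l_ g = 0]%N.

Definition C2_count : Prop := forall g, tau g = rotation_mx R 2 ->
  [/\ v_ g = 0, e_ g = 0 & l_ g = 0]%N \/ [/\ v_ g = 1, e_ g = 0 & l_ g = 2]%N.

Definition C4_count : Prop := forall g2 g4,
  tau g2 = rotation_mx R 2 -> tau g4 = rotation_mx R 4 ->
  ([/\ v_ g2 = 0, e_ g2 = 0 & l_ g2 = 0]
     /\ [/\ v_ g4 = 0, e_ g4 = 0 & l_ g4 = 0])%N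
  \/ ([/\ v_ g2 = 1, e_ g2 = 0 & l_ g2 = 2]
     /\ [/\ v_ g4 = 1, e_ g4 = 0 & l_ g4 = 0])%N.

Definition Cn_count (n : nat) : Prop :=
  if n == 2 then C2_count else if n == 4 then C4_count else rotation_count n.

Definition tau_tight : Prop :=
  [/\ tight G,
      symmetric_graph phiV phiL,
      is_Cs (range tau) -> reflection_count,
      forall n, (2 <= n)%N -> is_Cn n (range tau) -> Cn_count n
    & forall n, (2 <= n)%N -> is_Cnv n (range tau) ->
        reflection_count /\ Cn_count n].

End SymmetricFrameworks.

(* Main.v *)
(* Tightness is linear independence of the rows: those of a subgraph on V' are
   supported on V', and edge rows annihilate the three trivial motions.
   For the symmetry conditions, let P be the action of g on motions. With the
   edge rows chosen without orientation, A P = S A for the rigidity matrix A and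
   a signed permutation matrix S of the rows. As A is invertible,
   tr P = tr S, that is,
     tr (tau g) * v_g = e_g + l_{g,+} - l_{g,-}.
   Reflections have trace 0. A rotation of order at least 3 has no real
   eigenvector and fixes at most one vertex, at the origin, so e_n = l_n = 0 and
   v_n cos (2 pi / n) = 0. For the half-turn, l_2 = 2 v_2 + e_2, while the fixed
   loops all lie at the origin, so l_2 <= 2 v_2 by sparsity. *)
Require Import Defs.
From mathcomp Require Import all_boot all_order all_fingroup all_algebra.
From mathcomp Require Import all_classical all_reals all_analysis.
From mathcomp Require Import ring lra zify.
Local Open Scope classical_set_scope.
Local Open Scope ring_scope.

Set Implicit Arguments.
Unset Strict Implicit.
Unset Printing Implicit Defensive.

Import Order.TTheory GRing.Theory Num.Theory.

(** * Counting independent rows against motions that they annihilate *)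

Section RowCounting.
Variables (R : realType) (G : looped_graph).
Implicit Types a m : vert G -> 'cV[R]_2.

Lemma flat_row_mxvec (X : 'M[R]_(#|vert G|, 2)) :
  mxvec X = flat_row (fun v => (row (enum_rank v) X)^T).
Proof.
by congr mxvec; apply/matrixP => i k; rewrite !mxE enum_valK.
Qed.

Lemma flat_row_inj a m : flat_row a = flat_row m -> a =1 m.
Proof.
move=> /(can_inj mxvecK)/matrixP am v; apply/matrixP => k j.
by rewrite ord1; have := am (enum_rank v) k; rewrite !mxE enum_rankK.
Qed.

Lemma flat_rowD a m : flat_row a + flat_row m = flat_row (fun v => a v + m v).
Proof.
by rewrite -linearD; congr mxvec; apply/matrixP => i k; rewrite !mxE.
Qed.

Lemma flat_row_sum (I : finType) (P : pred I) (c : I -> R)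
    (t : I -> vert G -> 'cV[R]_2) :
  \sum_(i | P i) c i *: flat_row (t i) =
  flat_row (fun v => \sum_(i | P i) c i *: t i v).
Proof.
under eq_bigr do rewrite -linearZ.
rewrite -linear_sum; congr mxvec; apply/matrixP => i k.
rewrite !(mxE, summxE); apply: eq_bigr => j _.
by rewrite !mxE.
Qed.

(* The rows annihilate the k given motions and every motion supported outside *)
(* of V', a space of dimension k + 2 #|~: V'|.                                *)
Lemma row_count (n k : nat) (A : 'M[R]_(n, #|vert G| * 2))
    (a : 'I_n -> vert G -> 'cV[R]_2) (I' : {set 'I_n}) (V' : {set vert G})
    (t : 'I_k -> vert G -> 'cV[R]_2) :
    row_free A -> (forall i, row i A = flat_row (a i)) ->
    (forall i v, i \in I' -> v \notin V' -> a i v = 0) ->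
    (forall i j, i \in I' -> \sum_v dot (a i v) (t j v) = 0) ->
    (forall c : 'rV[R]_k,
      (forall v, v \in V' -> \sum_j c 0 j *: t j v = 0) -> c = 0) ->
  (#|I'| + k <= 2 * #|V'|)%N.
Proof.
move=> freeA rowA suppA orthA indep_t.
(* [N *m X] extends by zero a family [X] indexed by the complement of [V'], so the rows of [C] are
   the motions [t j] followed by a basis of the motions supported outside [V']. *)
pose N : 'M[R]_(#|vert G|, #|(~: V')%SET|) :=
  \matrix_(i, j) (enum_val i == enum_val j)%:R.
pose C := col_mx (\matrix_j flat_row (t j))
  (lin_mx (mulmx N) : 'M[R]_(#|(~: V')%SET| * 2, #|vert G| * 2)).
pose mot (c : 'rV[R]_k) (X : 'M[R]_(_, 2)) v :=
  \sum_j c 0 j *: t j v + (row (enum_rank v) (N *m X))^T.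
have rowC c b : row_mx c b *m C = flat_row (mot c (vec_mx b)).
  rewrite mul_row_col -flat_rowD -flat_row_mxvec; congr (_ + _).
    rewrite mulmx_sum_row -flat_row_sum; apply: eq_bigr => j _.
    by rewrite rowK.
  by rewrite -[b in LHS]vec_mxK mul_vec_lin.
have N_V' v X : v \in V' -> row (enum_rank v) (N *m X) = 0 :> 'rV[R]_2.
  move=> vV; apply/rowP => j; rewrite !mxE big1 // => i _.
  rewrite !mxE enum_rankK; case: eqP => [vi|_]; last by rewrite mul0r.
  by have := enum_valP i; rewrite -vi inE vV.
have freeC : row_free C.
  apply: inj_row_free => x; rewrite -[x]hsubmxK; move: (lsubmx x) (rsubmx x).
  move=> c b; rewrite rowC.
  have -> : 0 = flat_row (fun _ : vert G => 0 : 'cV[R]_2).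
    by rewrite -[LHS](linear0 mxvec); congr mxvec; apply/matrixP => i j; rewrite !mxE.
  move=> /flat_row_inj mot0.
  have c0 : c = 0.
    apply: indep_t => v vV; have := mot0 v.
    by rewrite /mot N_V' // trmx0 addr0.
  have b0 : vec_mx b = 0 :> 'M[R]_(_, 2).
    apply/matrixP => i j; have := mot0 (enum_val i).
    rewrite /mot c0 big1 => [|l _]; last by rewrite mxE scale0r.
    rewrite add0r => /matrixP/(_ j 0); rewrite !mxE (bigD1 i) //= big1.
      by rewrite !mxE enum_rankK eqxx mul1r addr0.
    move=> l li; rewrite !mxE enum_rankK (inj_eq enum_val_inj) eq_sym.
    by rewrite (negbTE li) mul0r.
  by rewrite c0 -[b]vec_mxK b0 linear0 row_mx0.
pose A' := rowsub (enum_val : 'I_#|I'| -> 'I_n) A.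
have freeA' : row_free A'.
  rewrite /A' rowsubE /row_free mxrankMfree //.
  apply/row_freeP; exists (rowsub enum_val 1%:M)^T.
  apply/matrixP => i j; rewrite !mxE (bigD1 (enum_val i)) //= big1 => [|l li].
    by rewrite !mxE eqxx mul1r addr0 (inj_eq enum_val_inj) eq_sym.
  by rewrite !mxE eq_sym (negbTE li) mul0r.
have AC : A' *m C^T = 0.
  apply: trmx_inj; rewrite trmx_mul trmxK trmx0.
  apply/row_matrixP => j; rewrite row_mul rowE row0.
  rewrite -[delta_mx _ _]hsubmxK rowC; apply/rowP => i.
  set m := mot _ _; have -> : (flat_row m *m A'^T) 0 i =
      (flat_row (a (enum_val i)) *m (flat_row m)^T) 0 0.
    rewrite -rowA [LHS]mxE [RHS]mxE; apply: eq_bigr => l _.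
    by rewrite [LHS]mulrC; congr (_ * _); rewrite !mxE.
  have iI := enum_valP i.
  rewrite flat_row_dot mxE /m /mot.
  under eq_bigr => v _ do rewrite /dot mulmxDr mxE mulmx_sumr summxE.
  rewrite big_split /= exchange_big /= big1 ?add0r ?big1 // => [v _|l _].
    have [vV|vV] := boolP (v \in V').
      by rewrite N_V' // trmx0 mulmx0 mxE.
    by rewrite suppA // trmx0 mul0mx mxE.
  under eq_bigr => v _ do rewrite -scalemxAr mxE.
  by rewrite -mulr_sumr orthA // mulr0.
(* [A'] and [C] have full row rank and orthogonal row spaces, so [#|I'| + k + 2 #|~: V'|] is at most
   [2 #|vert G|]. *)
have := mulmx0_rank_max AC; rewrite mxrank_tr (eqP freeA') (eqP freeC).
by have := cardsC V'; lia.
Qed.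
End RowCounting.

(** * Tightness of isostatic frameworks *)

Section Sparsity.
Variables (R : realType) (G : looped_graph).
Variables (p : vert G -> 'cV[R]_2) (q : loop G -> 'cV[R]_2).

Definition row_coef (i : 'I_(#|edges G| + #|loop G|)) : vert G -> 'cV[R]_2 :=
  match fintype.split i with
  | inl j => edge_coef p (enum_val j)
  | inr j => loop_coef q (enum_val j)
  end.

Lemma row_rigidity_mx i : row i (rigidity_mx p q) = flat_row (row_coef i).
Proof.
rewrite /row_coef -[in LHS](fintype.splitK i); case: (fintype.split i) => j /=.
  by rewrite rowKu rowK.
by rewrite rowKd rowK.
Qed.

Lemma loop_coef_dot l (m : vert G -> 'cV[R]_2) :
  \sum_v dot (loop_coef q l v) (m v) = dot (q l) (m (base l)).
Proof.
rewrite (bigD1 (base l)) //= big1 ?addr0 /loop_coef ?eqxx //.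
by move=> v /negbTE ->; rewrite /dot trmx0 mul0mx mxE.
Qed.

(** The rows of the subgraph are supported on [V'], so [row_count] applies. The two sparsity bounds
    are the cases [k = 0] and [k = 3]. *)
Lemma subgraph_count V' E' L' k (t : 'I_k -> vert G -> 'cV[R]_2) :
    row_free (rigidity_mx p q) -> is_subgraph V' E' L' ->
    (forall j u w, dot (p u - p w) (t j u - t j w) = 0) ->
    (forall j l, l \in L' -> dot (q l) (t j (base l)) = 0) ->
    (forall c : 'rV[R]_k,
      (forall v, v \in V' -> \sum_j c 0 j *: t j v = 0) -> c = 0) ->
  (#|E'| + #|L'| + k <= 2 * #|V'|)%N.
Proof.
move=> freeA [sE' sV' sL'] tE tL indep_t.
pose I' := [set i : 'I_(#|edges G| + #|loop G|) |
  match fintype.split i with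
  | inl j => enum_val j \in E'
  | inr j => enum_val j \in L'
  end]%SET.
have -> : (#|E'| + #|L'| = #|I'|)%N.
  rewrite -[RHS]sum1_card big_mkcond big_split_ord /=; congr (_ + _)%N.
    under eq_bigr => j _ do rewrite inE -[lshift _ j]/(unsplit (inl j)) unsplitK.
    rewrite -(big_enum_val (A := mem (edges G)) (fun e => if e \in E' then 1 else 0)%N).
    rewrite -sum1_card big_mkcond [RHS]big_mkcond /=.
    apply: eq_bigr => e _; have := fintype.subsetP sE' e.
    by case: (e \in E') => [->|_] //; case: ifP.
  under eq_bigr => j _ do rewrite inE -[rshift _ j]/(unsplit (inr j)) unsplitK.
  rewrite -(big_enum_val (A := mem (loop G)) (fun l => if l \in L' then 1 else 0)%N).
  by rewrite -sum1_card big_mkcond.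
apply: (row_count freeA row_rigidity_mx _ _ indep_t) => [i v|i j]; rewrite inE /row_coef;
    case: fintype.split => a aI.
- by move=> vV; rewrite /edge_coef ifN //; apply: contra vV; apply/fintype.subsetP/sV'.
- move=> vV; rewrite /loop_coef ifN //; apply: contra vV => /eqP->.
  exact: sL'.
- have /edges_card2/eqP/cards2P[u [w [uw ->]]] := enum_valP a.
  by rewrite edge_coef_dot.
- by rewrite loop_coef_dot tL.
Qed.

(** Translations along the axes for [j = 0, 1], and the infinitesimal rotation about the origin for
    [j = 2]. *)
Definition trivial_motion (j : 'I_3) (v : vert G) : 'cV[R]_2 :=
  \col_k (if j == 2%N :> nat then if k == 0 then - p v 1 0 else p v 0 0
          else (k == j :> nat)%:R).

Lemma sum_trivial_motion (c : 'rV[R]_3) v :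
  \sum_j c 0 j *: trivial_motion j v =
  \col_k (if k == 0 then c 0 0 - c 0 2 * p v 1 0 else c 0 1 + c 0 2 * p v 0 0).
Proof.
apply/colP => k; rewrite !big_ord_recl big_ord0 !mxE /= addr0.
have -> : lift ord0 ord0 = 1 :> 'I_3 by apply: val_inj.
have -> : lift ord0 (lift ord0 ord0) = 2 :> 'I_3 by apply: val_inj.
by case: k => [[|[]]] //= _; rewrite ?(mulr1, mulr0, add0r, mulrN).
Qed.

Lemma isostatic_tight : injective p -> isostatic p q -> tight G.
Proof.
move=> injp [rankA freeA]; split; last by rewrite -rankA; apply/esym/eqP.
split=> [V' E' L' sub|V' E' sub E'n0].
  rewrite -[leqLHS]addn0.
  apply: (@subgraph_count V' E' L' 0 (fun _ _ => 0)) => //; try by case.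
  by move=> c _; apply/rowP; case.
rewrite -[#|E'|]addn0 -[X in (_ + X + _)%N](cards0 (loop G)).
apply: (subgraph_count (t := trivial_motion)) => // [j u w|j l|c c0].
- rewrite dotE !big_ord_recl big_ord0 (_ : lift ord0 ord0 = 1); last exact: val_inj.
  by rewrite !mxE /=; case: j => [[|[|[]]]] //= _; ring.
- by rewrite inE.
have [e eE] := finset.set0Pn _ E'n0; case: sub => sE sV _.
have := edges_card2 (fintype.subsetP sE e eE); move/eqP/cards2P => [u [w [uw e_uw]]].
have {}sV := fintype.subsetP (sV _ eE).
have cE v : v \in e -> c 0 0 = c 0 2 * p v 1 0 /\ c 0 1 = - (c 0 2 * p v 0 0).
  move=> /sV/c0; rewrite sum_trivial_motion => /colP ck.
  have := ck 0; have := ck 1; rewrite !mxE /= => h1 h0.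
  by split; [apply/eqP; rewrite -subr_eq0 h0|apply/eqP; rewrite -addr_eq0 h1].
have [u0 u1] := cE u ltac:(by rewrite e_uw set21).
have [w0 w1] := cE w ltac:(by rewrite e_uw set22).
(* If [c 0 2] were nonzero, the combined motion would be an infinitesimal rotation, vanishing only
   at its centre; yet it vanishes at the distinct points [p u] and [p w]. *)
have c2 : c 0 2 = 0.
  apply/eqP; apply: contraNT uw => c2; apply/eqP/injp/colP => k.
  apply: (mulfI c2); case: k => [[|[]]] // lt_k.
    rewrite (_ : Ordinal lt_k = 0); last exact: val_inj.
    by apply: oppr_inj; rewrite -u1 -w1.
  rewrite (_ : Ordinal lt_k = 1); last exact: val_inj.
  by rewrite -u0 -w0.
apply/rowP => -[[|[|[]]] // lt_k]; rewrite mxE.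
- by rewrite (_ : Ordinal lt_k = 0) ?u0 ?c2 ?mul0r //; apply: val_inj.
- by rewrite (_ : Ordinal lt_k = 1) ?u1 ?c2 ?mul0r ?oppr0 //; apply: val_inj.
- by rewrite (_ : Ordinal lt_k = 2) //; apply: val_inj.
Qed.

End Sparsity.

(** * The trace of a symmetry on motions and on rows *)

Section TraceFormula.
Variables (R : realType) (G : looped_graph).

(** In the basis of elementary matrices the map is a Kronecker product. *)
Lemma trace_lin_mx_mul n k (Q : 'M[R]_n) (T : 'M[R]_k) :
  \tr (lin_mx (mulmxr T \o mulmx Q)) = \tr Q * \tr T.
Proof.
rewrite /mxtrace big_distrlr /= pair_bigA /=.
rewrite (reindex _ (curry_mxvec_bij _ _)) /=; apply: eq_bigr => -[i j] _ /=.
rewrite [LHS]mxE /= vec_mx_delta mxvecE mxE (bigD1 j) //= big1 => [|l lj]; last first.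
  rewrite !mxE big1 ?mul0r // => h _; rewrite !mxE (negbTE lj) andbF mulr0.
  by [].
rewrite addr0 mxE (bigD1 i) //= big1 => [|l li]; last first.
  by rewrite !mxE (negbTE li) mulr0.
by rewrite !mxE !eqxx addr0 mulr1.
Qed.

Variables (gT : finGroupType).
Variables (phiV : gT -> {perm vert G}) (phiL : gT -> {perm loop G}).
Variables (tau : gT -> 'M[R]_2) (p : vert G -> 'cV[R]_2) (q : loop G -> 'cV[R]_2).
Variable g : gT.

(** In this form the fixed edges are the nonzero diagonal entries of the permutation matrix of [g]
    on edges. *)
Lemma fixed_edgesE :
  fixed_edges phiV g = [set e in edges G | phiV g @: e == e]%SET.
Proof.
apply/setP => e; rewrite !inE; case: (boolP (e \in edges G)) => //= eE.
apply/idP/eqP => [/existsP[u /existsP[w /andP[/eqP-> ]]]|ge].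
  rewrite /fixes_pair imsetU1 imset_set1.
  by case/orP => /andP[/eqP-> /eqP->] //; rewrite finset.setUC.
have /edges_card2/eqP/cards2P[u [w [uw e_uw]]] := eE.
apply/existsP; exists u; apply/existsP; exists w; rewrite e_uw eqxx /=.
move: ge; rewrite e_uw imsetU1 imset_set1 => /setP ge.
have := ge (phiV g u); rewrite !inE eqxx /= => /esym gu.
have := ge (phiV g w); rewrite !inE eqxx orbT /= => /esym gw.
have := uw; rewrite -(inj_eq (@perm_inj _ (phiV g))) /fixes_pair.
by case/orP: gu => /eqP->; case/orP: gw => /eqP->; rewrite !eqxx ?orbT.
Qed.

Hypothesis autg : is_automorphism (phiV g) (phiL g).
Hypothesis symp : forall v, tau g *m p v = p (phiV g v).
Hypothesis symq : forall l,
  tau g *m q l = q (phiL g l) \/ tau g *m q l = - q (phiL g l).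
Hypothesis qn0 : forall l, q l != 0.

(** Sends a motion [m] to [v |-> tau g *m m (g^-1 v)]. Motions are stored with one vertex per row,
    hence the transpose of [tau g] on the right. *)
Let P := lin_mx (mulmxr (tau g)^T
  \o mulmx (\matrix_(i, j) (enum_val i == phiV g (enum_val j))%:R)) :
  'M[R]_(#|vert G| * 2, #|vert G| * 2).

Let flat_row_sym (m m' : vert G -> 'cV[R]_2) :
  (forall v, tau g *m m v = m' (phiV g v)) -> flat_row m *m P = flat_row m'.
Proof.
move=> mm'; rewrite mul_vec_lin /=; congr mxvec.
apply/matrixP => i k; rewrite [RHS]mxE -[in RHS](permKV (phiV g) (enum_val i)) -mm'.
rewrite mxE [RHS]mxE; apply: eq_bigr => j _.
rewrite mulrC !mxE; congr (_ * _).
rewrite (bigD1 (enum_rank ((phiV g)^-1%g (enum_val i)))) //= big1 => [|l li].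
  by rewrite !mxE enum_rankK permKV eqxx mul1r addr0.
rewrite !mxE; case: eqP => [il|_]; last by rewrite mul0r.
by case/eqP: li; rewrite il permK enum_valK.
Qed.

Let im_edge e : e \in edges G -> phiV g @: e \in edges G.
Proof.
move=> eE; have /edges_card2/eqP/cards2P[u [w [uw e_uw]]] := eE.
by move: eE; rewrite e_uw imsetU1 imset_set1 autg.1.
Qed.

(** [edge_coef] depends on the edge only as a set, so [g] permutes the edge rows without signs. *)
Let edge_coef_sym e v :
  tau g *m edge_coef p e v = edge_coef p (phiV g @: e) (phiV g v).
Proof.
rewrite /edge_coef (mem_imset _ _ (@perm_inj _ (phiV g))).
case: ifP => _; last by rewrite mulmx0.
rewrite big_imset /=; last by move=> ? ? _ _; apply: perm_inj.
rewrite mulmx_sumr; apply: eq_bigr => w _.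
by rewrite mulmxBr !symp.
Qed.

(** By [symq], the [else] branch is the case of opposite vectors. *)
Let eps l : R := if tau g *m q l == q (phiL g l) then 1 else -1.

Let loop_coef_sym l v :
  tau g *m loop_coef q l v = eps l *: loop_coef q (phiL g l) (phiV g v).
Proof.
rewrite /loop_coef autg.2 (inj_eq (@perm_inj _ (phiV g))) /eps.
case: ifP => _; last by rewrite mulmx0 scaler0.
case: eqP => [->|neq]; first by rewrite scale1r.
by case: (symq l) => // ->; rewrite scaleN1r.
Qed.

Lemma trace_formula : isostatic p q ->
  \tr (tau g) * #|fixed_vertices phiV g|%:R + #|loops_minus phiL tau q g|%:R
    = (#|fixed_edges phiV g| + #|loops_plus phiL tau q g|)%:R.
Proof.
move=> [rankA freeA].
pose A := rigidity_mx p q.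
(* The dimensions of [A] agree as numbers but not as types, so a left and a right inverse are
   obtained separately and then identified. *)
have /row_fullP[B BA] : row_full A by rewrite /row_full rankA mulnC.
have [B' AB'] := row_freeP freeA.
have AB : A *m B = 1%:M.
  by rewrite -[B](mulmx1) -AB' (mulmxA B) BA mul1mx.
pose SE : 'M[R]_#|edges G| :=
  \matrix_(i, j) (enum_val j == phiV g @: (enum_val i : {set vert G}))%:R.
pose SL : 'M[R]_#|loop G| :=
  \matrix_(i, j) (eps (enum_val i) * (enum_val j == phiL g (enum_val i))%:R).
have AP : A *m P = block_mx SE 0 0 SL *m A.
  rewrite /A /rigidity_mx mul_col_mx mul_block_col !mul0mx addr0 add0r.
  congr col_mx; apply/row_matrixP => i; rewrite !row_mul rowK.
    rewrite (flat_row_sym (edge_coef_sym _)) mulmx_sum_row.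
    have gE := im_edge (enum_valP i).
    rewrite (bigD1 (enum_rank_in gE (phiV g @: enum_val i))) //= big1 => [|j ji].
      by rewrite rowK !mxE enum_rankK_in // eqxx scale1r addr0.
    rewrite !mxE; case: eqP => [ij|_]; last by rewrite scale0r.
    by case/eqP: ji; apply: enum_val_inj; rewrite enum_rankK_in.
  rewrite (flat_row_sym (m' := fun v => eps (enum_val i) *:
      loop_coef q (phiL g (enum_val i)) v)) => [|v]; last exact: loop_coef_sym.
  rewrite mulmx_sum_row (bigD1 (enum_rank (phiL g (enum_val i)))) //= big1 => [|j ji].
    rewrite rowK !mxE enum_rankK eqxx mulr1 addr0 -linearZ; congr mxvec.
    by apply/matrixP => ? ?; rewrite !mxE.
  rewrite !mxE; case: eqP => [ij|_]; last by rewrite mulr0 scale0r.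
  by case/eqP: ji; rewrite -ij enum_valK.
have trP : \tr P = \tr SE + \tr SL.
  rewrite -(mxtrace_block _ 0 0) -[X in _ = \tr X]mulmx1 -AB mulmxA -AP.
  by rewrite [RHS]mxtrace_mulC mulmxA BA mul1mx.
have cardR (T : finType) (S : {set T}) : #|S|%:R = \sum_x (x \in S)%:R :> R.
  rewrite -sum1_card natr_sum big_mkcond; apply: eq_bigr => x _.
  by case: (x \in S).
move: trP; rewrite trace_lin_mx_mul mxtrace_tr mulrC.
have -> : \tr (\matrix_(i, j) (enum_val i == phiV g (enum_val j))%:R : 'M[R]_#|vert G|)
    = #|fixed_vertices phiV g|%:R.
  rewrite cardR /mxtrace.
  under eq_bigr => i _ do rewrite mxE.
  rewrite -(big_enum_val (A := mem (vert G)) (fun v => (v == phiV g v)%:R)) /=.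
  by apply: eq_bigr => v _; rewrite inE eq_sym; case: eqP.
have -> : \tr SE = #|fixed_edges phiV g|%:R.
  rewrite fixed_edgesE cardR /mxtrace.
  under eq_bigr => i _ do rewrite mxE.
  rewrite -(big_enum_val (A := mem (edges G)) (fun e => (e == phiV g @: e)%:R)) /=.
  rewrite [LHS]big_mkcond /=.
  by apply: eq_bigr => e _; rewrite !inE eq_sym; case: (e \in edges G).
have -> : \tr SL = #|loops_plus phiL tau q g|%:R - #|loops_minus phiL tau q g|%:R.
  rewrite !cardR /mxtrace.
  under eq_bigr => i _ do rewrite mxE.
  rewrite -(big_enum_val (A := mem (loop G)) (fun l => eps l * (l == phiL g l)%:R)) /=.
  rewrite -sumrB; apply: eq_bigr => l _; rewrite !inE /eps [l == _]eq_sym.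
  case: (phiL g l =P l) => [gl|_]; last by rewrite mulr0 subrr.
  (* As [q l] is nonzero, a fixed loop counts in exactly one of [loops_plus] and [loops_minus]. *)
  rewrite mulr1 gl /=; have qNq : q l != - q l.
    rewrite -addr_eq0; apply: contra (qn0 l); rewrite -mulr2n -scaler_nat scaler_eq0.
    by rewrite pnatr_eq0.
  case: (symq l); rewrite gl => ->.
    by rewrite eqxx (negbTE qNq) subr0.
  by rewrite eqxx eq_sym (negbTE qNq) sub0r.
by move=> ->; rewrite natrD addrA subrK.
Qed.

End TraceFormula.

(** * Traces and eigenvectors of reflections and rotations *)

Section PlaneIsometries.
Variable R : realType.
Implicit Types x : 'cV[R]_2.

Lemma reflection_trace (s : 'M[R]_2) : is_reflection s -> \tr s = 0.
Proof.
case=> u [uu ->]; rewrite linearB linearZ /= mxtrace_mulC uu !mxtrace1.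
by rewrite mulr1 subrr.
Qed.

Lemma rotation_mx2 : rotation_mx R 2 = - 1%:M.
Proof.
apply/matrixP => i j; rewrite !mxE mulrC mulKf ?pnatr_eq0 // cospi sinpi oppr0.
by case: eqP => _; rewrite ?mulr1n ?mulr0n ?oppr0 //; case: ifP.
Qed.

Lemma rotation_trace n : \tr (rotation_mx R n) = 2 * cos (2 * pi / n%:R).
Proof. by rewrite /mxtrace !big_ord_recl big_ord0 !mxE /=; ring. Qed.

Lemma rotation_angle_lt n (y : R) : 0 < y -> 2 < y * n%:R ->
  2 * pi / n%:R < y * pi :> R.
Proof.
move=> y0 hn; have n0 : 0 < n%:R :> R by rewrite -(pmulr_rgt0 _ y0); lra.
by rewrite ltr_pdivrMr // mulrAC ltr_pM2r // pi_gt0.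
Qed.

Lemma rotation_angle_gt0 n : (0 < n)%N -> 0 < 2 * pi / n%:R :> R.
Proof. by move=> n0; rewrite divr_gt0 ?ltr0n // mulr_gt0 // pi_gt0. Qed.

(** For an eigenvalue [c = 1] or [c = -1] the linear system has determinant
    [(cos t - c)^2 + (sin t)^2], positive because [0 < t < pi]. *)
Lemma rotation_eigen_eq0 n x : (2 < n)%N ->
  rotation_mx R n *m x = x \/ rotation_mx R n *m x = - x -> x = 0.
Proof.
move=> n2 eig.
pose t : R := 2 * pi / n%:R.
have s0 : 0 < sin t.
  apply: sin_gt0_pi; rewrite rotation_angle_gt0 ?(ltn_trans _ n2) //=.
  by rewrite -[ltRHS]mul1r rotation_angle_lt // mul1r ltr_nat.
have [c [x0 x1]] : exists c, (cos t - c) * x 0 0 - sin t * x 1 0 = 0 /\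
    sin t * x 0 0 + (cos t - c) * x 1 0 = 0.
  have sum2 (F : 'I_2 -> R) : \sum_i F i = F 0 + F 1.
    by rewrite big_ord_recl big_ord1; congr (_ + F _); apply: val_inj.
  case: eig => /colP eig; [exists 1|exists (-1)]; have := eig 0; have := eig 1;
    rewrite !mxE !sum2 !mxE /= -/t => e1 e0; split; lra.
have d0 : (cos t - c) ^+ 2 + sin t ^+ 2 != 0.
  by rewrite gt_eqF // ltr_wpDl ?sqr_ge0 // exprn_gt0.
(* Multiplying the system by its adjugate isolates each coordinate. *)
apply/colP => k; rewrite mxE; apply: (mulfI d0); rewrite mulr0.
case: k => [[|[]]] // lt_k.
  rewrite (_ : Ordinal lt_k = 0); last exact: val_inj.
  transitivity ((cos t - c) * ((cos t - c) * x 0 0 - sin t * x 1 0)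
    + sin t * (sin t * x 0 0 + (cos t - c) * x 1 0)); first by ring.
  by rewrite x0 x1 !mulr0 addr0.
rewrite (_ : Ordinal lt_k = 1); last exact: val_inj.
transitivity ((cos t - c) * (sin t * x 0 0 + (cos t - c) * x 1 0)
  - sin t * ((cos t - c) * x 0 0 - sin t * x 1 0)); first by ring.
by rewrite x0 x1 !mulr0 subr0.
Qed.

Lemma rotation_fixed_eq0 n x : (1 < n)%N -> rotation_mx R n *m x = x -> x = 0.
Proof.
rewrite leq_eqVlt => /predU1P[<-|n2 fx]; last by apply: rotation_eigen_eq0 n2 _; left.
rewrite rotation_mx2 mulNmx mul1mx => /eqP.
by rewrite eq_sym -addr_eq0 -mulr2n -scaler_nat scaler_eq0 pnatr_eq0 => /eqP.
Qed.

(** The sum of [x] and its image is fixed by the rotation, hence zero, so the rotation sends [x] to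
    [- x]. *)
Lemma rotation_sqr_fixed_eq0 n x : (2 < n)%N ->
  rotation_mx R n *m (rotation_mx R n *m x) = x -> x = 0.
Proof.
move=> n2 fx; apply: (rotation_eigen_eq0 n2); right; apply/eqP.
rewrite -addr_eq0; apply/eqP/(rotation_eigen_eq0 n2); left.
by rewrite mulmxDr fx addrC.
Qed.

(** The angle is acute from [n = 5] on and obtuse for [n = 3], where subtracting [pi] leaves
    [- pi / 3]. *)
Lemma cos_rotation_neq0 n : (2 < n)%N -> n != 4 -> cos (2 * pi / n%:R) != 0 :> R.
Proof.
move=> n2 n4; have pi0 := pi_gt0 R.
have [n5|n5] := ltnP 4 n.
  have h5 : 5%:R <= n%:R :> R by rewrite ler_nat.
  have t0 : 0 < 2 * pi / n%:R :> R by apply: rotation_angle_gt0; lia.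
  have t1 : 2 * pi / n%:R < 1 / 2 * pi :> R by apply: rotation_angle_lt; lra.
  by rewrite gt_eqF // cos_gt0_pihalf //; apply/andP; split; lra.
have -> : n = 3 by lia.
rewrite -[X in cos X](subrK pi) cosDpi oppr_eq0 gt_eqF // cos_gt0_pihalf //.
by apply/andP; split; lra.
Qed.

End PlaneIsometries.

(** * The counts for reflections and rotations *)

Section SymmetricIsostatic.
Variables (R : realType) (gT : finGroupType) (G : looped_graph).
Variables (phiV : gT -> {perm vert G}) (phiL : gT -> {perm loop G}).
Variables (tau : gT -> 'M[R]_2).
Variables (p : vert G -> 'cV[R]_2) (q : loop G -> 'cV[R]_2).
Hypotheses (symG : symmetric_graph phiV phiL) (orthtau : orthogonal_repr tau).
Hypotheses (injp : injective p) (symF : symmetric_framework phiV phiL tau p q).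
Hypothesis isoF : isostatic p q.

(** A zero vector would give a zero row among independent rows. *)
Lemma isostatic_loop_neq0 l : q l != 0.
Proof.
have [_ /row_freeP[B AB]] := isoF; apply/eqP => ql0.
pose i : 'I_(#|edges G| + #|loop G|) := rshift _ (enum_rank l).
have : row i (rigidity_mx p q) = 0.
  rewrite rowKd rowK enum_rankK -[RHS](linear0 mxvec); congr mxvec.
  apply/matrixP => j k; rewrite !mxE /loop_coef ql0.
  by case: ifP; rewrite mxE.
move=> /(congr1 (mulmx^~ B)); rewrite -row_mul AB mul0mx => /rowP/(_ i).
by rewrite !mxE eqxx => /eqP; rewrite oner_eq0.
Qed.

Lemma fixed_rotation_eq0 n g v : (1 < n)%N -> tau g = rotation_mx R n ->
  (phiV g v == v) = (p v == 0).
Proof.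
case: symF => symp _ _ _ _ n1 taug; apply/eqP/eqP => [gv|pv0].
  by apply: (rotation_fixed_eq0 n1); rewrite -taug symp gv.
by apply: injp; rewrite -symp pv0 mulmx0.
Qed.

(** The set of vertices at the origin does not mention [g] or [n], which lets rotations of different
    orders be compared. *)
Lemma card_fixed_rotation n g : (1 < n)%N -> tau g = rotation_mx R n ->
  fixed_vertices phiV g = [set v | p v == 0]%SET /\
  (#|fixed_vertices phiV g| <= 1)%N.
Proof.
move=> n1 taug; have -> : fixed_vertices phiV g = [set v | p v == 0]%SET.
  by apply/setP => v; rewrite !inE (fixed_rotation_eq0 v n1 taug).
split=> //; apply/card_le1_eqP => u v; rewrite !inE => /eqP pu /eqP pv.
by apply: injp; rewrite pu pv.
Qed.

Lemma isostatic_reflection_count : reflection_count phiV phiL tau q.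
Proof.
move=> g refl; case: symF => symp symq1 _ symq3 symq4; case: symG => autG _ _.
(* The sign comes from three clauses: order other than 2, involutions fixing [l], involutions moving
   [l]. *)
have symq l : tau g *m q l = q (phiL g l) \/ tau g *m q l = - q (phiL g l).
  have [g2|g2] := eqVneq #[g]%g 2%N; last by left; apply/symq1/eqP.
  have [gl|gl] := eqVneq (phiL g l) l; last by apply: symq4 => //; apply/eqP.
  by rewrite gl; apply: symq3.
have := trace_formula (autG g) (symp g) symq isostatic_loop_neq0 isoF.
by rewrite reflection_trace // mul0r add0r => /eqP; rewrite eqr_nat eq_sym => /eqP.
Qed.

(** The vertex count excludes [n = 4] because a quarter-turn has trace zero, so the trace formula
    says nothing about [v_4]. *)
Lemma isostatic_rotation_count n g : (2 < n)%N -> tau g = rotation_mx R n ->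
  [/\ #|fixed_edges phiV g| = 0%N, #|fixed_loops phiL g| = 0%N
    & n != 4 -> #|fixed_vertices phiV g| = 0%N].
Proof.
move=> n2 taug; case: symF => symp symq1 _ _ _; case: symG => autG _ _.
case: orthtau => -[tau1 tauM] _.
(* For an involution the squared rotation would be the identity, fixing the nonzero all-ones
   vector. *)
have g2 : #[g]%g <> 2%N.
  move=> og; have := expg_order g; rewrite og expgS expg1 => gg.
  have := @rotation_sqr_fixed_eq0 R n (const_mx 1) n2.
  rewrite mulmxA -taug -tauM ?inE // gg tau1 mul1mx => /(_ erefl)/colP/(_ 0).
  by rewrite !mxE => /eqP; rewrite oner_eq0.
have fl l : phiL g l != l.
  apply: contra (isostatic_loop_neq0 l) => /eqP gl; apply/eqP.
  by apply: (rotation_eigen_eq0 n2); left; rewrite -taug symq1 // gl.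
have l0 : fixed_loops phiL g = finset.set0.
  by apply/setP => l; rewrite !inE (negbTE (fl l)).
(* Both ends of a fixed edge are fixed by the square of [g], so both lie at the origin, against
   injectivity of [p]. *)
have e0 : fixed_edges phiV g = finset.set0.
  apply/setP => e; rewrite !inE; apply/negP => /andP[eE].
  case/existsP=> u /existsP[w /andP[/eqP e_uw fuw]].
  have := edges_card2 eE; rewrite e_uw cards2; case: eqVneq => // uw _.
  have fp v : phiV g (phiV g v) = v -> p v = 0.
    move=> ggv; apply: (rotation_sqr_fixed_eq0 n2).
    by rewrite -taug !symp ggv.
  case/eqP: uw; apply: injp.
  by rewrite !fp //; case/orP: fuw => /andP[/eqP gu /eqP gw];
    rewrite ?gu ?gw ?gu ?gw.
rewrite l0 e0 !cards0; split=> // n4.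
have := trace_formula (autG g) (symp g) (fun l => or_introl (symq1 g l g2))
  isostatic_loop_neq0 isoF.
have lp0 : loops_plus phiL tau q g = finset.set0.
  by apply/setP => l; rewrite inE l0 inE.
have lm0 : loops_minus phiL tau q g = finset.set0.
  by apply/setP => l; rewrite inE l0 inE.
rewrite lp0 lm0 e0 !cards0 addr0 taug rotation_trace => /eqP.
rewrite !mulf_eq0 (negbTE (cos_rotation_neq0 R n2 n4)) !pnatr_eq0 /=.
by move/eqP.
Qed.

Lemma isostatic_C2_count : C2_count phiV phiL tau.
Proof.
move=> g taug; case: symF => symp symq1 symq2 _ symq4; case: symG => autG _ _.
have symq l : tau g *m q l = q (phiL g l) \/ tau g *m q l = - q (phiL g l).
  have [g2|g2] := eqVneq #[g]%g 2%N; last by left; apply/symq1/eqP.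
  have [gl|gl] := eqVneq (phiL g l) l; last by apply: symq4 => //; apply/eqP.
  by rewrite gl; right; apply: symq2.
have tauN x : tau g *m x = - x by rewrite taug rotation_mx2 mulNmx mul1mx.
have lm : loops_minus phiL tau q g = fixed_loops phiL g.
  by apply/setP => l; rewrite inE tauN eqxx andbT.
have lp : loops_plus phiL tau q g = finset.set0.
  apply/setP => l; rewrite !inE tauN [- q l == _]eq_sym -addr_eq0 -mulr2n -scaler_nat.
  by rewrite scaler_eq0 pnatr_eq0 (negbTE (isostatic_loop_neq0 l)) andbF.
have := trace_formula (autG g) (symp g) symq isostatic_loop_neq0 isoF.
rewrite lm lp cards0 addn0 taug rotation_mx2 linearN /= mxtrace1 mulNr.
rewrite -natrM addrC => /eqP; rewrite subr_eq -natrD eqr_nat => /eqP count.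
(* A loop fixed by the half-turn is based at the vertex at the origin. *)
have [_ v1] := card_fixed_rotation (isT : 1 < 2)%N taug.
have : (#|fixed_loops phiL g| <= 2 * #|fixed_vertices phiV g|)%N.
  have [[sp _] _] := isostatic_tight injp isoF.
  have := sp (fixed_vertices phiV g) finset.set0 (fixed_loops phiL g).
  rewrite cards0 add0n; apply; split => [|e|l]; rewrite ?finset.sub0set ?inE //.
  by move=> /eqP gl; rewrite -(autG g).2 gl.
(* With [v <= 1], the relations [l = e + 2 v] and [l <= 2 v] force [e = 0] and [l = 2 v]. *)
move: v1 count.
by case: #|fixed_vertices _ _| => [|[|]] //= _ count lb; [left|right]; split=> //; lia.
Qed.

Lemma isostatic_Cn_count n : (2 <= n)%N -> Cn_count phiV phiL tau n.
Proof.
move=> n2; rewrite /Cn_count; case: eqVneq => [_|n2']; first exact: isostatic_C2_count.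
have {}n2 : (2 < n)%N by rewrite ltn_neqAle eq_sym n2'.
case: eqVneq => [_|n4]; last first.
  move=> g taug; have [e0 l0 v0] := isostatic_rotation_count n2 taug.
  by split=> //; apply: v0.
rewrite /C4_count /= => g2 g4 tau2 tau4.
have [e0 l0 _] := isostatic_rotation_count (isT : 2 < 4)%N tau4.
have [v2 _] := card_fixed_rotation (isT : 1 < 2)%N tau2.
have [v4 _] := card_fixed_rotation (isT : 1 < 4)%N tau4.
(* The half-turn and the quarter-turn fix the same vertices, so the alternative for [g2] decides
   [v_4]. *)
by case: (isostatic_C2_count tau2) => -[vg eg lg]; [left|right];
  split=> //; split=> //; rewrite v4 -v2.
Qed.

End SymmetricIsostatic.

Theorem theorem3p5 (R : realType) (gT : finGroupType) (G : looped_graph)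
    (phiV : gT -> {perm vert G}) (phiL : gT -> {perm loop G})
    (tau : gT -> 'M[R]_2)
    (p : vert G -> 'cV[R]_2) (q : loop G -> 'cV[R]_2) :
  symmetric_graph phiV phiL ->
  orthogonal_repr tau ->
  is_Cs_Cn_or_Cnv (range tau) ->
  injective p ->
  symmetric_framework phiV phiL tau p q ->
  isostatic p q ->
  tau_tight phiV phiL tau q.
Proof.
move=> symG orthtau _ injp symF isoF.
have refl := isostatic_reflection_count symG symF isoF.
have rot n : (2 <= n)%N -> Cn_count phiV phiL tau n.
  exact: isostatic_Cn_count symG orthtau injp symF isoF n.
split=> //; first exact: isostatic_tight injp isoF.
- by move=> n n2 _; apply: rot.
- by move=> n n2 _; split=> //; apply: rot.
Qed.
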